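(* Let $m,n\ge1$, let $a_1,\dots,a_m\in\mathbb R^n$, and let $P\in\mathbb R^{n\times n}$ have positive-definite symmetric part. There is a constant $C_P=C_P(a_1,\dots,a_m,P)\ge1$, depending only on $a_1,\dots,a_m$ and $P$, such that for all $b_1,\dots,b_m\in\mathbb R$, all $B\ge0$ and all $x_0\in\mathbb R^n$, every run $(x_k)_{k\ge0}$ of the oblique relaxation procedure (defined in the context) satisfies $$\sup_{k\ge0}\|x_k\|\le M,\qquad M:=C_P(1+\|x_0\|+B+\Delta_b),$$ where $$\Delta_b:=\max\{0,b_1,\dots,b_m\}-\min\{0,b_1,\dots,b_m\}.$$ No feasibility assumption on the system $\langle a_i,x\rangle\ge b_i$ $(i=1,\dots,m)$ is required. If, in addition, there exist $c\in\mathbb R^n$ and $\gamma>0$ such that $$\langle c,Pa_i\rangle\ge\gamma\qquad\text{for all }i=1,\dots,m,$$ then the procedure terminates at a feasible point of the system after a finite number $T$ of corrections satisfying $$T\le\frac{\|c\|}{\gamma}\,(M+\|x_0\|).$$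
   Context: Oblique relaxation procedure for the system $\langle a_i,x\rangle\ge b_i$, $i=1,\dots,m$, with tolerance $B\ge0$: start at $x_0\in\mathbb R^n$ and stop at index $k$ if all inequalities hold at $x_k$. At each index $k$ before stopping, choose any $i_k\in\{1,\dots,m\}$ with $$\langle a_{i_k},x_k\rangle-b_{i_k}\le\min_{1\le i\le m}(\langle a_i,x_k\rangle-b_i)+B,$$ and set $x_{k+1}=x_k+Pa_{i_k}$. After stopping, the state is kept constant. The inner product and norm are the standard Euclidean ones. *)

(* Defs.v *)
From HB Require Import structures.
From mathcomp Require Import all_boot all_order all_algebra.
From mathcomp Require Import boolp classical_sets reals constructive_ereal ereal.

Set Implicit Arguments.
Unset Strict Implicit.
Unset Printing Implicit Defensive.

Import Order.TTheory GRing.Theory Num.Theory.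
Local Open Scope ring_scope.

(* Systems of m.+1 >= 1 inequalities in dimension n.+1 >= 1; vectors are
   columns. *)

Definition dot (R : realType) (n : nat) (u v : 'cV[R]_n) : R :=
  (u^T *m v) 0 0.

(* The Euclidean norm; MathComp-Analysis's `|u| is the sup norm on matrices. *)
Definition enorm (R : realType) (n : nat) (u : 'cV[R]_n) : R :=
  Num.sqrt (dot u u).

Definition sym_part (R : realType) (n : nat) (P : 'M[R]_n) : 'M[R]_n :=
  2^-1 *: (P + P^T).

Definition pos_def (R : realType) (n : nat) (S : 'M[R]_n) : Prop :=
  S^T = S /\ forall u : 'cV[R]_n, u != 0 -> 0 < dot u (S *m u).

Section Procedure.
Variables (R : realType) (m n : nat).
Variables (a : 'I_m.+1 -> 'cV[R]_n.+1) (b : 'I_m.+1 -> R).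

Definition residual (y : 'cV[R]_n.+1) (i : 'I_m.+1) : R := dot (a i) y - b i.

(* The default value of the iterated minimum is one of its terms, so this is
   the minimum of the residuals alone. *)
Definition min_residual (y : 'cV[R]_n.+1) : R :=
  \big[Num.min/residual y ord0]_(i < m.+1) residual y i.

Definition feasible (y : 'cV[R]_n.+1) : Prop := forall i, b i <= dot (a i) y.

Definition oblique_run (P : 'M[R]_n.+1) (B : R) (x0 : 'cV[R]_n.+1)
    (x : nat -> 'cV[R]_n.+1) : Prop :=
  x 0%N = x0 /\
  forall k : nat,
    (feasible (x k) -> x k.+1 = x k) /\
    (~ feasible (x k) -> exists i : 'I_m.+1,
       residual (x k) i <= min_residual (x k) + B /\
       x k.+1 = x k + P *m a i).

(* T is then also the number of corrections made. *)
Definition stops_at (x : nat -> 'cV[R]_n.+1) (T : nat) : Prop :=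
  feasible (x T) /\ forall k : nat, (k < T)%N -> ~ feasible (x k).

(* The default value 0 takes part in both the maximum and the minimum. *)
Definition spread : R :=
  \big[Num.max/0]_(i < m.+1) b i - \big[Num.min/0]_(i < m.+1) b i.

End Procedure.

(* Main.v *)
Require Import Defs.
From mathcomp Require Import all_boot all_order all_algebra.
From mathcomp Require Import boolp classical_sets reals constructive_ereal ereal.
From mathcomp Require Import zify ring lra.

(** Call <a_i, x> the i-th reading of x.  Up to stopping, a run of the procedure
    is a near-minimal run: the reading of the selected index at x_t is at most D
    and within D of the least reading, where D = B + spread b
    (oblique_near_min_run).  The b_i then disappear, and the point is a bound
      |x_n - x_0| <= c (1 + D + sum_(i in I) |<a_i, x_0>|)
    for near-minimal runs that select indices in a set I, where c depends only
    on I, the a_i and P (near_min_run_bounded).  It is proved by induction on I.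
    When the total reading N = sum_(i in I) |<a_i, x>| is large compared with
    1 + D, the run is in one of two regimes.

    Trapped: no reading is below - 2 eps N.  The indices then split into a
    proper subset J of small readings and a rest whose readings are larger by a
    big factor.  As long as the run has moved little, only J can be selected;
    as long as only J is selected, the induction hypothesis for J says that the
    run moves little.  So J is used for ever (trapped_run).

    Descending: the selected reading is below - eps N.  The continuous model is
    x' = P g with g in the convex hull of the active a_i; along it the concave
    function f = min_i <a_i, x> grows at rate <g, P g> >= lam |g|^2, and g stays
    away from 0.  In discrete time this chain rule can fail on a given time
    scale, because the selected vectors may oscillate on that scale.  Compare
    therefore the averages of the selected vectors over blocks of lengths
    l0 M^j.  Either the average over a block is close to the one over its last
    sub-block, and the chain rule holds up to a small error; or the mean square
    of the averages over the sub-blocks exceeds the square of the average over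
    the block by a fixed amount.  Mean squares are bounded, so the second case
    cannot persist over many scales, and f grows linearly (window_growth,
    multiscale_gain).  As f is negative in this regime and at least - N
    initially, the regime lasts a time O(1 + D + N) (descent_time).

    A run thus keeps returning to moderate readings, descends for a controlled
    time, or gets trapped for good, so its readings are bounded.  Displacements
    lie in the image under P of the span of the a_i, where coercivity of P lets
    readings control the norm (displacement_le_reading).

    Termination: <c, x_k> grows by at least gamma at each correction while
    |x_k| stays bounded (infeasible_steps_le). *)

Set Implicit Arguments.
Unset Strict Implicit.
Unset Printing Implicit Defensive.

Import Order.TTheory GRing.Theory Num.Theory.
Local Open Scope ring_scope.

(** * Euclidean geometry of column vectors *)

Section Euclid.
Variable R : realType.
Implicit Types n p : nat.

Lemma dotE n (u v : 'cV[R]_n) : dot u v = \sum_i u i 0 * v i 0.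
Proof. by rewrite /dot mxE; apply: eq_bigr => i _; rewrite mxE. Qed.

Lemma dotC n (u v : 'cV[R]_n) : dot u v = dot v u.
Proof. by rewrite !dotE; apply: eq_bigr => i _; rewrite mulrC. Qed.

Lemma dotDr n (u v w : 'cV[R]_n) : dot u (v + w) = dot u v + dot u w.
Proof. by rewrite /dot mulmxDr mxE. Qed.

Lemma dotZr n (u v : 'cV[R]_n) c : dot u (c *: v) = c * dot u v.
Proof. by rewrite /dot -scalemxAr mxE. Qed.

Lemma dotNr n (u v : 'cV[R]_n) : dot u (- v) = - dot u v.
Proof. by rewrite -scaleN1r dotZr mulN1r. Qed.

Lemma dotBr n (u v w : 'cV[R]_n) : dot u (v - w) = dot u v - dot u w.
Proof. by rewrite dotDr dotNr. Qed.

Lemma dot0r n (u : 'cV[R]_n) : dot u 0 = 0.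
Proof. by rewrite /dot mulmx0 mxE. Qed.

Lemma dotDl n (u v w : 'cV[R]_n) : dot (v + w) u = dot v u + dot w u.
Proof. by rewrite dotC dotDr !(dotC u). Qed.

Lemma dotZl n (u v : 'cV[R]_n) c : dot (c *: v) u = c * dot v u.
Proof. by rewrite dotC dotZr (dotC u). Qed.

Lemma dotBl n (u v w : 'cV[R]_n) : dot (v - w) u = dot v u - dot w u.
Proof. by rewrite dotC dotBr !(dotC u). Qed.

Lemma dot_suml n (I : Type) (r : seq I) (Q : pred I) (F : I -> 'cV[R]_n) u :
  dot (\sum_(i <- r | Q i) F i) u = \sum_(i <- r | Q i) dot (F i) u.
Proof.
by elim/big_rec2: _ => [|i y1 y2 _ <-]; rewrite ?dotDl // dotC dot0r.
Qed.

Lemma dot_mulmxl n p (M : 'M[R]_(p, n)) u v : dot (M *m u) v = dot u (M^T *m v).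
Proof. by rewrite /dot trmx_mul mulmxA. Qed.

Lemma dot_ge0 n (u : 'cV[R]_n) : 0 <= dot u u.
Proof. by rewrite dotE; apply: sumr_ge0 => i _; rewrite -expr2 sqr_ge0. Qed.

Lemma dot_eq0 n (u : 'cV[R]_n) : (dot u u == 0) = (u == 0).
Proof.
apply/eqP/eqP => [|->]; last by rewrite dot0r.
rewrite dotE => /psumr_eq0P u0; apply/matrixP => i j; rewrite ord1 mxE.
apply/eqP; rewrite -sqrf_eq0 expr2; apply/eqP/u0 => // k _.
by rewrite -expr2 sqr_ge0.
Qed.

(** Expand the form at q u - r v, with q = <v, S v> and r = <u, S v>. *)
Lemma pos_def_CauchySchwarz n (S : 'M[R]_n) (u v : 'cV[R]_n) : pos_def S ->
  dot u (S *m v) ^+ 2 <= dot u (S *m u) * dot v (S *m v).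
Proof.
case=> S_sym S_pos; have [->|v0] := eqVneq v 0.
  by rewrite mulmx0 !dot0r mulr0 expr0n.
have q_gt0 := S_pos _ v0; set q := dot v _ in q_gt0 *.
set r := dot u (S *m v); set p := dot u _.
have S_ge0 w : 0 <= dot w (S *m w).
  by have [->|/S_pos/ltW//] := eqVneq w 0; rewrite mulmx0 dot0r.
have vu : dot v (S *m u) = r by rewrite dotC dot_mulmxl S_sym.
have := S_ge0 (q *: u - r *: v).
rewrite mulmxBr -!scalemxAr !dotBr !dotZr !dotBl !dotZl vu -/p -/q -/r => h.
have {}h : 0 <= q * (p * q - r ^+ 2).
  by apply: le_trans h _; rewrite le_eqVlt; apply/orP; left; apply/eqP; ring.
by rewrite pmulr_rge0 // subr_ge0 in h.
Qed.

Lemma pos_def1 n : pos_def (1%:M : 'M[R]_n).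
Proof.
split=> [|u u0]; first exact: trmx1.
by rewrite mul1mx lt_def dot_eq0 u0 dot_ge0.
Qed.

Lemma enorm_ge0 n (u : 'cV[R]_n) : 0 <= enorm u.
Proof. exact: sqrtr_ge0. Qed.

Lemma enormE n (u : 'cV[R]_n) : dot u u = enorm u ^+ 2.
Proof. by rewrite sqr_sqrtr // dot_ge0. Qed.

Lemma dot_CauchySchwarz n (u v : 'cV[R]_n) : `|dot u v| <= enorm u * enorm v.
Proof.
rewrite -ler_sqr ?nnegrE ?mulr_ge0 ?enorm_ge0 // real_normK ?num_real //.
rewrite exprMn -!enormE.
by have := pos_def_CauchySchwarz u v (pos_def1 n); rewrite !mul1mx.
Qed.

Lemma dot_le n (u v : 'cV[R]_n) : dot u v <= enorm u * enorm v.
Proof. exact: le_trans (ler_norm _) (dot_CauchySchwarz _ _). Qed.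

Lemma enorm0 n : enorm (0 : 'cV[R]_n) = 0.
Proof. by rewrite /enorm dot0r sqrtr0. Qed.

Lemma enormZ n (c : R) (v : 'cV[R]_n) : enorm (c *: v) = `|c| * enorm v.
Proof.
rewrite /enorm dotZl dotZr mulrA -expr2 sqrtrM ?sqr_ge0 //.
by rewrite sqrtr_sqr.
Qed.

Lemma ler_enormD n (u v : 'cV[R]_n) : enorm (u + v) <= enorm u + enorm v.
Proof.
rewrite -ler_sqr ?nnegrE ?addr_ge0 ?enorm_ge0 // -enormE.
rewrite dotDr !dotDl (dotC v u) !enormE.
by have := dot_le u v; lra.
Qed.

Lemma ler_enorm_sum n (I : Type) (r : seq I) (Q : pred I) (F : I -> 'cV[R]_n) :
  enorm (\sum_(i <- r | Q i) F i) <= \sum_(i <- r | Q i) enorm (F i).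
Proof.
elim/big_rec2: _ => [|i y1 y2 _ h]; first by rewrite enorm0.
exact: le_trans (ler_enormD _ _) (lerD _ _).
Qed.

Lemma enorm_le n (u : 'cV[R]_n) c : 0 <= c -> (forall i, `|u i 0| <= c) ->
  enorm u <= n%:R * c.
Proof.
move=> c0 uc; rewrite -ler_sqr ?nnegrE ?mulr_ge0 ?enorm_ge0 // -enormE dotE.
case: n u uc => [|n] u uc; first by rewrite big_ord0 mul0r expr0n.
have h : \sum_i u i 0 * u i 0 <= \sum_(i < n.+1) c ^+ 2.
  apply: ler_sum => i _; rewrite -expr2 -real_normK ?num_real //.
  by rewrite ler_sqr ?nnegrE.
apply: le_trans h _; rewrite sumr_const card_ord exprMn -[_ *+ n.+1]mulr_natl.
by rewrite ler_wpM2r ?sqr_ge0 // -natrX ler_nat leq_pmulr.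
Qed.

Lemma mulmx_bounded n p (M : 'M[R]_(p, n)) :
  exists2 c, 0 < c & forall u : 'cV[R]_n, enorm (M *m u) <= c * enorm u.
Proof.
pose s := \sum_i enorm (row i M)^T.
have s0 : 0 <= s by apply: sumr_ge0 => i _; apply: enorm_ge0.
exists (p%:R * s + 1) => [|u]; first by rewrite ltr_wpDl ?mulr_ge0.
have h : enorm (M *m u) <= p%:R * (s * enorm u).
  apply: enorm_le => [|i]; first by rewrite mulr_ge0 ?enorm_ge0.
  have -> : (M *m u) i 0 = dot (row i M)^T u.
    by rewrite dotE mxE; apply: eq_bigr => j _; rewrite !mxE.
  apply: le_trans (dot_CauchySchwarz _ _) _; rewrite ler_wpM2r ?enorm_ge0 //.
  rewrite /s (bigD1 i) //= lerDl; apply: sumr_ge0 => j _; exact: enorm_ge0.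
by apply: le_trans h _; rewrite mulrDl mul1r mulrA lerDl enorm_ge0.
Qed.

Lemma pos_def_unitmx n (S : 'M[R]_n) : pos_def S -> S \in unitmx.
Proof.
case=> S_sym S_pos; rewrite -row_free_unit; apply: inj_row_free => v vS.
have [//|] := eqVneq v^T 0 => [/(congr1 trmx)|/S_pos].
  by rewrite trmxK trmx0.
by rewrite -S_sym -trmx_mul vS trmx0 dot0r ltxx.
Qed.

(** A lower bound without compactness of the sphere: Cauchy-Schwarz for S,
    applied to u and S^-1 u, gives |u|^4 <= <u, S u> <S^-1 u, u>, and the last
    factor is at most c |u|^2. *)
Lemma pos_def_coercive n (S : 'M[R]_n) : pos_def S ->
  exists2 l, 0 < l & forall u : 'cV[R]_n, l * dot u u <= dot u (S *m u).
Proof.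
move=> hS; have [c c0 hc] := mulmx_bounded (invmx S).
exists c^-1 => [|u]; first by rewrite invr_gt0.
rewrite mulrC ler_pdivrMr // mulrC.
have [->|u0] := eqVneq u 0; first by rewrite mulmx0 !dot0r mulr0.
have uu : 0 < dot u u by rewrite lt_def dot_eq0 u0 dot_ge0.
rewrite -(ler_pM2r uu) -mulrA mulrCA.
have := pos_def_CauchySchwarz u (invmx S *m u) hS.
rewrite mulKVmx ?pos_def_unitmx // expr2 => /le_trans; apply.
rewrite ler_wpM2l //.
  by case: hS => _ /(_ _ u0) /ltW.
rewrite enormE expr2 mulrA.
apply: le_trans (dot_le _ _) _.
by rewrite ler_wpM2r ?enorm_ge0.
Qed.

Lemma dot_sym_part n (P : 'M[R]_n) (u : 'cV[R]_n) :
  dot u (sym_part P *m u) = dot u (P *m u).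
Proof.
rewrite /sym_part -scalemxAl mulmxDl dotZr dotDr -dot_mulmxl (dotC _ u).
by lra.
Qed.

End Euclid.

(** * Near-minimal runs and their readings *)

Section Runs.
Variables (R : realType) (d m : nat) (a : 'I_m -> 'cV[R]_d) (P : 'M[R]_d).
Implicit Types (I J : {set 'I_m}) (x : nat -> 'cV[R]_d) (s : nat -> 'I_m).

(** A seminorm: it ignores the component of v orthogonal to the a_i, i in I. *)
Definition reading I (v : 'cV[R]_d) : R := \sum_(i in I) `|dot (a i) v|.

(** Finite stretches only, so that the notion also covers what happens before
    stopping; the constraint ranges over I alone, so that a run confined to a
    smaller set of indices is again such a run. *)
Definition near_min_run I (D : R) x s (n : nat) : Prop :=
  forall t, (t < n)%N ->
    [/\ s t \in I,
        forall j, j \in I -> dot (a (s t)) (x t) <= dot (a j) (x t) + D,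
        dot (a (s t)) (x t) <= D
      & x t.+1 = x t + P *m a (s t)].

Definition window_sum s (k l : nat) : 'cV[R]_d :=
  \sum_(k <= t < k + l) a (s t).

Lemma reading_ge0 I v : 0 <= reading I v.
Proof. by apply: sumr_ge0 => i _; apply: normr_ge0. Qed.

Lemma dot_le_reading I v i : i \in I -> `|dot (a i) v| <= reading I v.
Proof.
by move=> iI; rewrite /reading (bigD1 i) //= lerDl; apply: sumr_ge0.
Qed.

Lemma reading_sub I J v : I \subset J -> reading I v <= reading J v.
Proof.
move=> /fintype.subsetP IJ; rewrite /reading big_mkcond [leRHS]big_mkcond /=.
by apply: ler_sum => i _; case: ifP => [/IJ ->|_] //; case: ifP.
Qed.

Lemma reading_le I v c : 0 <= c -> (forall i, i \in I -> `|dot (a i) v| <= c) ->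
  reading I v <= m%:R * c.
Proof.
move=> c0 h; apply: (@le_trans _ _ (\sum_(i < m) c)).
  by rewrite /reading big_mkcond; apply: ler_sum => i _; case: ifP => // /h.
by rewrite sumr_const card_ord mulr_natl.
Qed.

Lemma readingD I v w : reading I (v + w) <= reading I v + reading I w.
Proof.
by rewrite -big_split; apply: ler_sum => i _; rewrite dotDr ler_normD.
Qed.

Lemma readingN I v : reading I (- v) = reading I v.
Proof. by apply: eq_bigr => i _; rewrite dotNr normrN. Qed.

(** Readings over I control a vector up to changes that they do not see: solving
    the linear system by a fixed pseudo-inverse costs a fixed factor. *)
Lemma bounded_representative I : exists2 c, 0 < c &
  forall v, exists2 y, forall i, i \in I -> dot (a i) y = dot (a i) v &
    enorm y <= c * reading I v.
Proof.
pose A := \matrix_(i < m, j < d) (if i \in I then a i j 0 else 0).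
have AE v i : (A *m v) i 0 = if i \in I then dot (a i) v else 0.
  rewrite mxE; case: ifPn => iI.
    by rewrite dotE; apply: eq_bigr => j _; rewrite mxE iI.
  by apply: big1 => j _; rewrite mxE (negPf iI) mul0r.
have [c c0 hc] := mulmx_bounded (pinvmx A).
exists (c * (m%:R + 1)) => [|v]; first by rewrite mulr_gt0 ?ltr_wpDl.
exists (pinvmx A *m (A *m v)) => [i iI|].
  have : A *m (pinvmx A *m (A *m v)) = A *m v.
    by rewrite (mulmxA A) (mulmxA (A *m _)) mulmxKpV.
  by move=> /matrixP /(_ i 0); rewrite !AE iI.
apply: le_trans (hc _) _; rewrite -mulrA ler_wpM2l ?(ltW c0) //.
apply: (@le_trans _ _ (m%:R * reading I v)).
  apply: enorm_le => [|i]; first exact: reading_ge0.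
  rewrite AE; case: ifP => iI; first exact: dot_le_reading.
  by rewrite normr0 reading_ge0.
by rewrite mulrDl mul1r lerDl reading_ge0.
Qed.

Lemma near_min_run_shift I D x s n k : (k <= n)%N -> near_min_run I D x s n ->
  near_min_run I D (fun t => x (k + t)%N) (fun t => s (k + t)%N) (n - k)%N.
Proof.
move=> kn h t; rewrite ltn_subRL => /h [? ? ? xS]; split=> //.
by rewrite addnS.
Qed.

Lemma near_min_run_prefix I D x s n k : (k <= n)%N -> near_min_run I D x s n ->
  near_min_run I D x s k.
Proof. by move=> kn h t tk; apply: h; apply: leq_trans tk kn. Qed.

Lemma run_displacement I D x s n k l : near_min_run I D x s n ->
  (k + l <= n)%N -> x (k + l)%N = x k + P *m window_sum s k l.
Proof.
move=> h; elim: l => [|l IH] kl.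
  by rewrite addn0 /window_sum addn0 big_geq // mulmx0 addr0.
have [_ _ _ xS] : [/\ _, _, _ & _] := h (k + l)%N ltac:(lia).
rewrite addnS xS IH; last by lia.
by rewrite /window_sum addnS big_nat_recr ?leq_addr //= mulmxDr addrA.
Qed.

Variable A : R.
Hypotheses (A_ge1 : 1 <= A) (a_le : forall i, enorm (a i) <= A)
  (Pa_le : forall i, enorm (P *m a i) <= A).

Lemma enorm_window_sum s k l : enorm (window_sum s k l) <= A * l%:R.
Proof.
apply: le_trans (ler_enorm_sum _ _ _) _.
apply: (@le_trans _ _ (\sum_(k <= t < k + l) A)); first exact: ler_sum.
by rewrite sumr_const_nat addKn mulr_natr.
Qed.

Lemma enorm_Pwindow_sum s k l : enorm (P *m window_sum s k l) <= A * l%:R.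
Proof.
rewrite /window_sum mulmx_sumr; apply: le_trans (ler_enorm_sum _ _ _) _.
apply: (@le_trans _ _ (\sum_(k <= t < k + l) A)); first exact: ler_sum.
by rewrite sumr_const_nat addKn mulr_natr.
Qed.

Lemma dot_a_le i v c : enorm v <= c -> `|dot (a i) v| <= A * c.
Proof.
move=> vc; apply: le_trans (dot_CauchySchwarz _ _) _.
by apply: ler_pM => //; apply: enorm_ge0.
Qed.

Lemma reading_le_enorm I v : reading I v <= m%:R * (A * enorm v).
Proof.
apply: reading_le => [|i _]; last exact: dot_a_le.
by rewrite mulr_ge0 ?enorm_ge0 //; exact: le_trans ler01 A_ge1.
Qed.

Lemma run_step_le I D x s n k l : near_min_run I D x s n -> (k + l <= n)%N ->
  enorm (x (k + l)%N - x k) <= A * l%:R.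
Proof.
by move=> h kl; rewrite (run_displacement h kl) addrC addKr enorm_Pwindow_sum.
Qed.

Lemma reading_run_le I D x s n k l : near_min_run I D x s n -> (k + l <= n)%N ->
  reading I (x (k + l)%N) <= reading I (x k) + m%:R * (A * (A * l%:R)).
Proof.
move=> h kl; rewrite -[x (k + l)%N](subrK (x k)) addrC.
apply: le_trans (readingD _ _ _) _; rewrite lerD2l.
apply: le_trans (reading_le_enorm _ _) _.
rewrite !ler_wpM2l ?(run_step_le h) //; exact: le_trans ler01 A_ge1.
Qed.

(** * Runs trapped by small readings *)

(** Otherwise each step of the chain gains an element. *)
Lemma chain_gap (T : finType) (F : nat -> {set T}) :
  (forall j, F j \subset F j.+1) -> F #|T| != [set: T]%SET ->
  exists2 j, (j < #|T|)%N & F j = F j.+1.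
Proof.
move=> Fsub FT; apply: contrapT => noj.
have cardF j : (j <= #|T|)%N -> (j <= #|F j|)%N.
  elim: j => // j IH jT; apply: leq_ltn_trans (IH (ltnW jT)) _.
  apply: proper_card; rewrite finset.properEneq Fsub andbT.
  by apply/eqP => Fj; apply: noj; exists j.
move/negP: FT; apply; rewrite eqEcard finset.subsetT cardsT; exact: cardF.
Qed.

(** Thresholds growing by a factor K leave, by pigeonhole, two consecutive ones
    with no reading in between; the readings below the gap come from a proper
    subset F, because they cannot add up to the total reading.  The factor K is
    chosen so that the displacement allowed by the induction hypothesis for F
    cannot bring a reading above the gap down to D. *)
Lemma trapped_run I (C1 : R) : 0 <= C1 ->
  (forall J, J \proper I -> forall (D : R) x s n, 0 <= D -> near_min_run J D x s n ->
     enorm (x n - x 0%N) <= C1 * (1 + D + reading J (x 0%N))) ->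
  exists eps, [/\ 0 < eps, eps <= 1 &
    forall (D : R) x s n, 0 <= D -> near_min_run I D x s n ->
      1 + D <= eps * reading I (x 0%N) ->
      (forall i, i \in I -> - (2 * eps * reading I (x 0%N)) <= dot (a i) (x 0%N)) ->
      enorm (x n - x 0%N) <= C1 * (1 + D + reading I (x 0%N))].
Proof.
move=> C1_ge0 IH.
have A_ge0 : 0 <= A by apply: le_trans A_ge1.
have m1_gt0 : 0 < m%:R + 1 :> R by rewrite ltr_wpDl.
pose K := A * (C1 * (m%:R + 1)) + 1.
have K_ge1 : 1 <= K by rewrite lerDr !mulr_ge0 // ltW.
have K_gt0 : 0 < K by apply: lt_le_trans K_ge1.
have Km_ge1 : 1 <= K ^+ m by apply: exprn_ege1.
have Km_gt0 : 0 < K ^+ m by apply: exprn_gt0.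
pose E := (m%:R + 1) * (2 * K ^+ m).
have E_ge1 : 1 <= E.
  by apply: mulr_ege1; [rewrite lerDr | apply: mulr_ege1 => //; lra].
exists E^-1; split; first by rewrite invr_gt0 (lt_le_trans ltr01).
  by rewrite invf_le1 // (lt_le_trans ltr01).
have eps_gt0 : 0 < E^-1 by rewrite invr_gt0 (lt_le_trans ltr01).
set eps := E^-1 in eps_gt0 *.
move=> D x s n D_ge0 xrun; set r := reading I _ => D_le lowI.
have r_gt0 : 0 < r.
  by rewrite -(pmulr_rgt0 _ eps_gt0); apply: lt_le_trans D_le; rewrite ltr_pwDl.
pose e j := 2 * eps * r * K ^+ j.
have e_gt0 j : 0 < e j by rewrite !mulr_gt0 ?exprn_gt0.
have eS j : e j.+1 = K * e j by rewrite /e exprS; ring.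
have e_mono j : e j <= e j.+1 by rewrite eS ler_peMl // ltW.
have e_ge j : eps * r <= e j.
  have h : 1 <= K ^+ j by apply: exprn_ege1.
  apply: (@le_trans _ _ (2 * eps * r)); last by rewrite ler_peMr // !mulr_ge0 // ltW.
  by rewrite -mulrA ler_peMl ?ler1n // mulr_ge0 // ltW.
have e0_ge j : 2 * eps * r <= e j.
  by rewrite ler_peMr ?exprn_ege1 // !mulr_ge0 // ltW.
pose F j := [set i in I | dot (a i) (x 0%N) <= e j]%SET.
have FI j : F j \subset I by apply/fintype.subsetP => i; rewrite inE => /andP[].
have Fread j : reading (F j) (x 0%N) <= m%:R * e j.
  apply: reading_le => [|i]; first exact: ltW.
  rewrite inE => /andP[iI v_le]; rewrite ler_norml v_le andbT.
  by apply: le_trans (lowI i iI); rewrite lerN2.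
(* Even the last threshold satisfies m * e m < r, so not all of I lies below. *)
have FmI : F m != I.
  apply/eqP => FmI; have := Fread m; rewrite FmI -/r => /le_lt_trans.
  have em : e m = (m%:R + 1)^-1 * r.
    rewrite /e /eps /E; field.
    by rewrite !gt_eqF.
  have /[swap] /[apply] : m%:R * e m < r; last by rewrite ltxx.
  by rewrite em mulrA gtr_pMl // ltr_pdivrMr // mul1r ltrDl.
have [j jm Fj] : exists2 j, (j < #|'I_m|)%N & F j = F j.+1.
  apply: chain_gap => [j|].
    apply/fintype.subsetP => i; rewrite !inE => /andP[-> /le_trans -> //].
  rewrite card_ord; apply: contra FmI => /eqP FmT.
  by rewrite finset.eqEsubset FI FmT finset.subsetT.
have Fproper : F j \proper I.
  rewrite finset.properEneq FI andbT; apply: contra FmI => /eqP FjI.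
  rewrite finset.eqEsubset FI -{1}FjI; apply/fintype.subsetP => i.
  rewrite !inE => /andP[-> /le_trans ->] //; rewrite card_ord in jm.
  by rewrite ler_wpM2l // ?ler_weXn2l ?(ltnW jm) // !mulr_ge0 // ltW.
have e1 : eps * r + m%:R * e j <= (m%:R + 1) * e j.
  by rewrite mulrDl mul1r addrC lerD2l.
(* As long as only F j is used the run stays near x 0, hence the readings of
   I outside F j stay above D and are not selected at the next step. *)
have Frun t : (t <= n)%N -> near_min_run (F j) D x s t.
  elim: t => // t IHt tn; have {}IHt := IHt (ltnW tn) => t' t't.
  have [stI smin sD xS] := xrun t' (leq_trans t't tn).
  split=> // [|i iF]; last by apply: smin; apply: (fintype.subsetP (FI j)).
  apply: contraT => stF.
  have xt : enorm (x t' - x 0%N) <= C1 * ((m%:R + 1) * e j).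
    have t'run := near_min_run_prefix (t't : (t' <= t)%N) IHt.
    apply: le_trans (IH _ Fproper _ _ _ _ D_ge0 t'run) _.
    rewrite ler_wpM2l //; apply: le_trans e1; exact: lerD.
  have := dot_a_le (s t') xt; rewrite ler_norml => /andP[+ _].
  move: stF; rewrite Fj inE stI /= -ltNge eS dotBr => v_gt.
  have := e_ge j; rewrite /K in v_gt; rewrite mulrDl mul1r -!mulrA in v_gt.
  by clear -v_gt D_le sD; move=> *; lra.
apply: le_trans (IH _ Fproper _ _ _ _ D_ge0 (Frun n (leqnn n))) _.
by rewrite ler_wpM2l // lerD2l reading_sub.
Qed.
End Runs.

(** * Growth of the least reading over several time scales *)

Section Progress.
Variables (R : realType) (d m : nat) (a : 'I_m -> 'cV[R]_d) (P : 'M[R]_d).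
Variables (A : R).
Hypotheses (A_ge1 : 1 <= A) (a_le : forall i, enorm (a i) <= A)
  (Pa_le : forall i, enorm (P *m a i) <= A).
Implicit Types (I J : {set 'I_m}).

Lemma variance_sum (M : nat) (G : nat -> 'cV[R]_d) (S := \sum_(q < M) G q) :
  (0 < M)%N ->
  \sum_(q < M) dot (G q - M%:R^-1 *: S) (G q - M%:R^-1 *: S) =
  \sum_(q < M) dot (G q) (G q) - M%:R^-1 * dot S S.
Proof.
move=> M0; have Mn0 : M%:R != 0 :> R by rewrite pnatr_eq0 -lt0n.
transitivity (\sum_(q < M) (dot (G q) (G q)
    + (- 2 * M%:R^-1 * dot (G q) S + M%:R^-1 ^+ 2 * dot S S))).
  apply: eq_bigr => q _; rewrite dotBl !dotBr !dotZr !dotZl (dotC S); ring.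
rewrite big_split /= big_split /= -mulr_sumr -dot_suml -/S sumr_const card_ord.
rewrite -[_ *+ M]mulr_natr; congr (_ + _); field.
by [].
Qed.

Lemma window_sum_split (s : nat -> 'I_m) k l M :
  window_sum a s k (M * l) = \sum_(q < M) window_sum a s (k + q * l) l.
Proof.
elim: M => [|M IH]; first by rewrite big_ord0 /window_sum addn0 big_geq.
rewrite big_ord_recr /= -IH /window_sum mulSn (addnC l) addnA.
by rewrite [LHS](@big_cat_nat _ _ _ (k + M * l)) ?leq_addr.
Qed.

Section OneRun.
Variables (I : {set 'I_m}) (D : R) (x : nat -> 'cV[R]_d) (s : nat -> 'I_m).
Variable n : nat.
Hypotheses (D_ge0 : 0 <= D) (xrun : near_min_run a P I D x s n).
Local Notation W := (window_sum a s).
(* The selected reading stands for the least one, from which it differs by at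
   most D. *)
Let phi t := dot (a (s t)) (x t).

(** Near-minimality at time k alone: the index selected at time t is a competitor
    there.  This is the concavity inequality for the least reading. *)
Lemma phi_gain k t : (k < n)%N -> (t < n)%N ->
  phi k + dot (a (s t)) (x t - x k) - D <= phi t.
Proof.
move=> kn tn; have [stI _ _ _] := xrun tn; have [_ smin _ _] := xrun kn.
by have := smin _ stI; rewrite /phi dotBr; lra.
Qed.

Lemma dot_step_le i k l : (k + l <= n)%N ->
  `|dot (a i) (x (k + l)%N - x k)| <= A * (A * l%:R).
Proof. by move=> kl; apply: (dot_a_le a_le); apply: (run_step_le _ xrun). Qed.

Lemma phi_drop k l : (k + l < n)%N ->
  phi k - A * (A * l%:R) - D <= phi (k + l)%N.
Proof.
move=> kln; have kn : (k < n)%N by lia.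
have := phi_gain kn kln; have := dot_step_le (s (k + l)%N) (ltnW kln).
by rewrite ler_norml => /andP[+ _]; lra.
Qed.

(** The concavity inequality between k and each t of the last l steps, averaged
    over these t.  What enters is the correlation, through P, of the last
    sub-window with the whole window. *)
Lemma phi_steady_gain k p l : (0 < l)%N -> (k + p + l < n)%N ->
  phi k + l%:R^-1 * dot (W (k + p)%N l) (P *m W k (p + l))
    - 2 * (A * (A * l%:R)) - 2 * D <= phi (k + p + l)%N.
Proof.
move=> l0 kpl; set e := (k + p + l)%N.
have l_gt0 : 0 < l%:R :> R by rewrite ltr0n.
set c := 2 * (A * (A * l%:R)) + 2 * D.
suff : dot (W (k + p)%N l) (P *m W k (p + l)) <= l%:R * (phi e - phi k + c).
  rewrite -ler_pdivrMl // /c; lra.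
rewrite /window_sum dot_suml -/(W k (p + l)).
apply: (@le_trans _ _ (\sum_(k + p <= t < k + p + l) (phi e - phi k + c)));
  last by rewrite sumr_const_nat addKn mulr_natl.
rewrite big_nat [leRHS]big_nat; apply: ler_sum => t /andP[t1 t2].
have te : e = (t + (e - t))%N by rewrite /e; lia.
have g1 : phi k + dot (a (s t)) (x t - x k) - D <= phi t.
  by apply: phi_gain; lia.
have g2 : phi t - A * (A * (e - t)%:R) - D <= phi e.
  by rewrite [in phi e]te; apply: phi_drop; lia.
have g3 : `|dot (a (s t)) (x e - x t)| <= A * (A * (e - t)%:R).
  by rewrite [in x e]te; apply: dot_step_le; lia.
have g4 : x e = x k + P *m W k (p + l).
  by rewrite /e -addnA; apply: (run_displacement xrun); lia.
have g5 : A * (A * (e - t)%:R) <= A * (A * l%:R).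
  have A0 := le_trans ler01 A_ge1.
  by rewrite !ler_wpM2l // ler_nat /e; lia.
move: g3 g1; rewrite g4 !dotBr !dotDr ler_norml => /andP[_ g3].
by move: g3 g2 g5; rewrite /c; lra.
Qed.

(* The constants are tied by a chain of choices: kappa is half the bound
   lam eps^2 on the rate of the continuous model, then eta and M are chosen
   against kappa, then tau from eta and M, and last sg and Jmax, the number of
   scales. *)
Variables (lam eps : R).
Hypotheses (lam_gt0 : 0 < lam) (eps_gt0 : 0 < eps).
Hypothesis P_coercive : forall v : 'cV[R]_d, lam * dot v v <= dot v (P *m v).
Let kappa := lam * eps ^+ 2 / 2.

Variables (M l0 Jmax : nat) (eta sg C : R).
Let tau := eta ^+ 2 / M%:R.
Hypotheses (M_gt0 : (0 < M)%N) (l0_gt0 : (0 < l0)%N) (D_le : D <= l0%:R).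
Hypotheses (eta_gt0 : 0 < eta) (sg_ge0 : 0 <= sg).
Hypothesis eta_small : eta * A <= kappa / 2.
Hypothesis M_large : 2 * A ^+ 2 + 2 <= kappa / 2 * M%:R.
Hypothesis C_large : 1 + A ^+ 2 + sg * A ^+ 2 <= C.
Hypothesis sg_small : sg * (Jmax%:R * tau) + sg * A ^+ 2 - C <= kappa.
Hypothesis W_large : forall k l, (k + l < n)%N -> (l <= M ^ Jmax * l0)%N ->
  eps * l%:R <= enorm (W k l).

(** Energy increment.  Per unit of time the bound is sg |mean|^2 plus a term that
    gains sg * tau at each scale.  If the mean over the last sub-window deviates
    from the overall mean by more than eta, the average of the squares over the
    M sub-windows exceeds the overall square by tau, and summing the bounds of
    the sub-windows pays for the gain.  If not, the concavity inequality gives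
    the rate kappa, which dominates the bound at every scale up to Jmax. *)
Lemma window_growth j k : (j <= Jmax)%N -> (k + M ^ j * l0 < n)%N ->
  (M ^ j * l0)%:R * (sg * (j%:R * tau) - C)
    + sg * dot (W k (M ^ j * l0)) (W k (M ^ j * l0)) / (M ^ j * l0)%:R
  <= phi (k + M ^ j * l0)%N - phi k.
Proof.
have A_ge0 := le_trans ler01 A_ge1.
have tau_ge0 : 0 <= tau by rewrite divr_ge0 ?sqr_ge0.
have WA k' l : dot (W k' l) (W k' l) <= A ^+ 2 * l%:R ^+ 2.
  rewrite enormE -exprMn ler_sqr ?nnegrE ?mulr_ge0 ?enorm_ge0 //.
  exact: enorm_window_sum.
have WAdiv k' l : (0 < l)%N -> sg * dot (W k' l) (W k' l) / l%:R
    <= l%:R * (sg * A ^+ 2).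
  move=> lgt0; rewrite ler_pdivrMr ?ltr0n //.
  have := ler_wpM2l sg_ge0 (WA k' l); set z := sg * dot _ _.
  by move/le_trans; apply; rewrite le_eqVlt; apply/orP; left; apply/eqP; ring.
elim: j k => [|j IH] k jJ.
  rewrite expn0 mul1n mul0r mulr0 sub0r => kl.
  have h1 := phi_drop kl; have h2 := WAdiv k l0 l0_gt0.
  have h3 : l0%:R * (1 + A ^+ 2 + sg * A ^+ 2) <= l0%:R * C.
    by rewrite ler_wpM2l.
  have h4 : A * (A * l0%:R) = l0%:R * A ^+ 2 by ring.
  by move: h1 h2 h3; rewrite h4 !mulrDr mulr1; move: D_le; lra.
set l := (M ^ j * l0)%N in IH *.
have -> : (M ^ j.+1 * l0 = M * l)%N by rewrite expnS mulnA.
move=> kL; set L := (M * l)%N in kL *.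
have l_gt0 : (0 < l)%N by rewrite muln_gt0 expn_gt0 M_gt0.
have L_gt0 : (0 < L)%N by rewrite muln_gt0 M_gt0.
have lR : 0 < l%:R :> R by rewrite ltr0n.
have LR : 0 < L%:R :> R by rewrite ltr0n.
have MR : 0 < M%:R :> R by rewrite ltr0n.
have Ml : (M * l = M.-1 * l + l)%N by rewrite -[in LHS](prednK M_gt0) mulSn addnC.
set S := W k L; set G := fun q => W (k + q * l)%N l.
have SG : S = \sum_(q < M) G q by apply: window_sum_split.
set g := L%:R^-1 *: S; set h := l%:R^-1 *: G M.-1.
have [steady|unsteady] := leP (enorm (h - g)) eta.
  have D_l : D <= l%:R.
    by apply: le_trans D_le _; rewrite ler_nat leq_pmull // expn_gt0 M_gt0.
  have gain := @phi_steady_gain k (M.-1 * l) l l_gt0.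
  rewrite -addnA -Ml in gain; have {gain} := gain kL; rewrite -/S -/(G _) => gain.
  have Ldot : l%:R^-1 * dot (G M.-1) (P *m S) = L%:R * dot h (P *m g).
    by rewrite /h /g -scalemxAr dotZl dotZr; field; rewrite !gt_eqF.
  have scaled (z : 'cV[R]_d) c : enorm z <= c * L%:R -> enorm (L%:R^-1 *: z) <= c.
    by move=> zc; rewrite enormZ ger0_norm ?invr_ge0 // mulrC ler_pdivrMr.
  have Pg : enorm (P *m g) <= A.
    by rewrite /g -scalemxAr; apply/scaled/enorm_Pwindow_sum.
  have gg : eps ^+ 2 <= dot g g.
    rewrite enormE ler_sqr ?nnegrE ?enorm_ge0 ?(ltW eps_gt0) //.
    rewrite enormZ ger0_norm ?invr_ge0 // mulrC ler_pdivlMr //.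
    apply: W_large => //.
    by rewrite /L /l mulnA -expnS leq_mul2r leq_pexp2l ?orbT.
  have hg : - (eta * A) <= dot (h - g) (P *m g).
    have := dot_CauchySchwarz (h - g) (P *m g); rewrite ler_norml => /andP[+ _].
    by apply: le_trans; rewrite lerN2 ler_pM ?enorm_ge0.
  have low : 3 / 2 * kappa <= dot h (P *m g).
    have := ler_wpM2l (ltW lam_gt0) gg => /le_trans /(_ (P_coercive g)).
    by move: hg eta_small; rewrite dotBl /kappa; lra.
  have err : 2 * (A * (A * l%:R)) + 2 * D <= kappa / 2 * L%:R.
    rewrite /L natrM [leRHS]mulrA; apply: (le_trans _ (ler_wpM2r (ltW lR) M_large)).
    by move: D_l; lra.
  have gainL : kappa * L%:R <= phi (k + L)%N - phi k.
    have := ler_wpM2l (ltW LR) low; rewrite -Ldot.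
    by move: gain err; lra.
  apply: le_trans gainL; have := WAdiv k L L_gt0; rewrite -/S => h1.
  have h2 : sg * (j.+1%:R * tau) <= sg * (Jmax%:R * tau).
    by rewrite ler_wpM2l // ler_wpM2r // ler_nat.
  have h3 : L%:R * (sg * (j.+1%:R * tau) + sg * A ^+ 2 - C) <= L%:R * kappa.
    by rewrite ler_wpM2l ?(ltW LR) //; move: h2 sg_small; lra.
  by move: h1 h3; lra.
have LE : L%:R = M%:R * l%:R :> R := natrM _ M l.
have IHq (q : 'I_M) : l%:R * (sg * (j%:R * tau) - C) + sg * dot (G q) (G q) / l%:R
    <= phi (k + q.+1 * l)%N - phi (k + q * l)%N.
  have ql : (k + q.+1 * l <= k + L)%N by rewrite leq_add2l leq_mul2r ltn_ord orbT.
  have -> : (k + q.+1 * l = k + q * l + l)%N by rewrite mulSn addnA addnAC.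
  rewrite mulSn addnA addnAC in ql.
  by apply: IH; [apply: ltnW | apply: leq_ltn_trans ql kL].
have tele : \sum_(q < M) (phi (k + q.+1 * l)%N - phi (k + q * l)%N) =
          phi (k + L)%N - phi k.
  rewrite -(big_mkord xpredT
    (fun q => phi (k + q.+1 * l)%N - phi (k + q * l)%N)).
  by rewrite (telescope_sumr (fun q => phi (k + q * l)%N)) // mul0n addn0.
rewrite -tele; apply: (le_trans _ (ler_sum _ (fun q _ => IHq q))).
rewrite big_split /= sumr_const card_ord -[_ *+ M]mulr_natl -mulr_suml -mulr_sumr.
have var := variance_sum G M_gt0; rewrite -SG in var.
have dev : (eta * l%:R) ^+ 2 <=
    \sum_(q < M) dot (G q - M%:R^-1 *: S) (G q - M%:R^-1 *: S).
  have M1 : (M.-1 < M)%N by rewrite prednK.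
  rewrite (bigD1 (Ordinal M1)) //=; apply: (@le_trans _ _
    (dot (G M.-1 - M%:R^-1 *: S) (G M.-1 - M%:R^-1 *: S))).
    have -> : G M.-1 - M%:R^-1 *: S = l%:R *: (h - g).
      rewrite scalerBr /h /g !scalerA divff ?gt_eqF // scale1r.
      by congr (_ - _ *: _); rewrite LE invfM mulrCA mulfV ?mulr1 ?gt_eqF.
    rewrite dotZl dotZr mulrA -expr2 enormE exprMn mulrC ler_wpM2l ?sqr_ge0 //.
    by rewrite ler_sqr ?nnegrE ?enorm_ge0 ?(ltW eta_gt0) // ltW.
  by rewrite lerDl; apply: sumr_ge0 => q _; apply: dot_ge0.
have {}dev : (eta * l%:R) ^+ 2 + M%:R^-1 * dot S S <= \sum_(q < M) dot (G q) (G q).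
  by move: dev; rewrite var; lra.
have linv : 0 <= l%:R^-1 :> R by rewrite invr_ge0.
have := ler_wpM2r linv (ler_wpM2l sg_ge0 dev).
have -> : sg * ((eta * l%:R) ^+ 2 + M%:R^-1 * dot S S) / l%:R =
    L%:R * (sg * tau) + sg * dot S S / L%:R.
  rewrite LE /tau; move: (l%:R : R) lR (M%:R : R) MR => lr lr0 Mr Mr0.
  by field; rewrite !gt_eqF.
by rewrite -natr1 !mulrDl mul1r mulrDr LE; lra.
Qed.

End OneRun.
End Progress.

Section Bounded.
Variables (R : realType) (d m : nat) (a : 'I_m -> 'cV[R]_d) (P : 'M[R]_d).
Variables (A lam : R).
Hypotheses (A_ge1 : 1 <= A) (a_le : forall i, enorm (a i) <= A)
  (Pa_le : forall i, enorm (P *m a i) <= A) (lam_gt0 : 0 < lam)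
  (P_coercive : forall v : 'cV[R]_d, lam * dot v v <= dot v (P *m v)).
Implicit Types (I J : {set 'I_m}) (x : nat -> 'cV[R]_d) (s : nat -> 'I_m).

(** * Duration of the descending regime *)

(** Choice of the constants of the energy increment.  After Jmax scales the
    accumulated gain is C + kappa / 4, which outweighs the loss C of the first
    scale. *)
Lemma multiscale_gain (eps : R) : 0 < eps ->
  exists2 kappa : R, 0 < kappa & exists2 w : nat, (0 < w)%N &
  forall I (D : R) x s n l0, 0 <= D -> near_min_run a P I D x s n ->
    (0 < l0)%N -> D <= l0%:R ->
    (forall k l, (k + l < n)%N -> (l <= w * l0)%N ->
       eps * l%:R <= enorm (window_sum a s k l)) ->
  forall k, (k + w * l0 < n)%N ->
    kappa * (w * l0)%:R <=
    dot (a (s (k + w * l0)%N)) (x (k + w * l0)%N) - dot (a (s k)) (x k).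
Proof.
move=> eps_gt0.
have A_gt0 : 0 < A by apply: lt_le_trans A_ge1.
pose kappa := lam * eps ^+ 2 / 2.
have kappa_gt0 : 0 < kappa by rewrite divr_gt0 ?mulr_gt0 ?exprn_gt0.
pose eta := kappa / 2 / A.
have eta_gt0 : 0 < eta by apply: divr_gt0 => //; apply: divr_gt0.
pose b1 := (2 * A ^+ 2 + 2) / (kappa / 2).
have b1_gt0 : 0 < b1.
  by apply: divr_gt0; [rewrite addr_gt0 ?mulr_gt0 ?exprn_gt0 | apply: divr_gt0].
pose M := Num.bound b1.
have M_gt : b1 < M%:R by apply: archi_boundP; apply: ltW.
have M_gt0 : (0 < M)%N by rewrite -(ltr_nat R); apply: lt_trans M_gt.
pose tau := eta ^+ 2 / M%:R.
have tau_gt0 : 0 < tau by rewrite divr_gt0 ?exprn_gt0 ?ltr0n.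
pose C := 1 + 2 * A ^+ 2.
have A2_gt0 : 0 < A ^+ 2 by rewrite exprn_gt0.
have Ck_gt0 : 0 < C + kappa / 4 by rewrite /C; lra.
pose b2 := (C + kappa / 4) / tau * (1 + 4 * A ^+ 2 / kappa).
have b2_gt0 : 0 < b2 by rewrite !mulr_gt0 ?invr_gt0 // addr_gt0 ?divr_gt0 ?mulr_gt0.
pose J := Num.bound b2.
have J_gt : b2 < J%:R by apply: archi_boundP; apply: ltW.
have J_gt0 : 0 < J%:R :> R by apply: lt_trans J_gt.
pose sg := (C + kappa / 4) / (J%:R * tau).
have Jt_gt0 : 0 < J%:R * tau by apply: mulr_gt0.
have sg_gt0 : 0 < sg by apply: divr_gt0.
have sgJ : sg * (J%:R * tau) = C + kappa / 4.
  by rewrite /sg divfK // gt_eqF.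
have sg_le : sg * (1 + 4 * A ^+ 2 / kappa) <= 1.
  have -> : sg * (1 + 4 * A ^+ 2 / kappa) = b2 / J%:R.
    by rewrite /sg /b2 invfM [_^-1 * _]mulrC mulrA mulrAC.
  by rewrite ler_pdivrMr // mul1r ltW.
have sg1 : sg <= 1.
  apply: le_trans sg_le; rewrite ler_peMr ?(ltW sg_gt0) // lerDl.
  by rewrite ltW // divr_gt0 ?mulr_gt0.
have sgA : sg * A ^+ 2 <= kappa / 4.
  have : sg * (4 * A ^+ 2 / kappa) <= 1.
    by apply: le_trans sg_le; rewrite ler_wpM2l ?(ltW sg_gt0) // lerDr.
  by rewrite mulrA ler_pdivrMr // mul1r; lra.
exists (kappa / 4); first exact: divr_gt0.
exists (M ^ J)%N => [|I D x s n l0 D_ge0 xrun l0_gt0 D_le W_large k kn].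
  by rewrite expn_gt0 M_gt0.
have := @window_growth _ _ _ _ _ _ A_ge1 a_le Pa_le _ _ _ _ _ D_ge0 xrun _ _
  lam_gt0 eps_gt0 P_coercive _ _ _ _ _ C M_gt0 l0_gt0 D_le eta_gt0 (ltW sg_gt0)
  _ _ _ _ W_large J k (leqnn _) kn.
rewrite -/kappa -/tau sgJ => h; apply: le_trans (h _ _ _ _).
- rewrite addrAC subrr add0r mulrC lerDl.
  apply: divr_ge0; last exact: ler0n.
  by apply: mulr_ge0; [apply: ltW | apply: dot_ge0].
- by rewrite divfK ?gt_eqF.
- by rewrite [leRHS]mulrC -ler_pdivrMr; [apply: ltW | apply: divr_gt0].
- by rewrite /C; have := ler_wpM2r (ltW A2_gt0) sg1; lra.
- by move: sgA; lra.
Qed.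

Lemma reading_run_ge I (D : R) x s n k l : near_min_run a P I D x s n ->
  (k + l <= n)%N ->
  reading a I (x k) <= reading a I (x (k + l)%N) + m%:R * (A * (A * l%:R)).
Proof.
move=> xrun kl; have := run_step_le Pa_le xrun kl.
rewrite -{2}[x k](subKr (x (k + l)%N)) => step.
apply: le_trans (readingD _ _ _ _) _; rewrite lerD2l readingN.
apply: le_trans (reading_le_enorm A_ge1 a_le _ _) _.
by rewrite !ler_wpM2l // (le_trans ler01 A_ge1).
Qed.

Lemma dot_window_sum I (D : R) x s n k l (u v : 'cV[R]_d) :
  near_min_run a P I D x s n -> (k + l <= n)%N ->
  (forall i, i \in I -> dot (a i) u = dot (a i) v) ->
  dot (window_sum a s k l) u = dot (window_sum a s k l) v.
Proof.
move=> xrun kl uv; rewrite /window_sum !dot_suml big_nat [RHS]big_nat.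
apply: eq_bigr => t /andP[_ tkl].
by have [stI _ _ _] := xrun t (leq_trans tkl kl); apply: uv.
Qed.

(** Over a window much shorter than the size of the readings, every selected
    vector pairs with x k to at most - (eps / 2) N; a representative of x k of
    norm O(N) then forces the sum of the window to have length at least a
    multiple of its duration, as the growth over several scales requires. *)
Lemma descent_time I (eps : R) : 0 < eps -> eps <= 1 ->
  exists2 rho : R, 0 < rho & exists2 c : R, 0 < c &
  forall (D : R) x s n, 0 <= D -> near_min_run a P I D x s n ->
    (forall t, (t < n)%N -> rho * (1 + D) <= reading a I (x t)) ->
    (forall t, (t < n)%N ->
       dot (a (s t)) (x t) < - (eps * reading a I (x t))) ->
    n%:R <= c * (1 + D + reading a I (x 0%N)).
Proof.
move=> eps_gt0 eps_le1; have [cy cy_gt0 hy] := bounded_representative a I.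
have [kappa kappa_gt0 [w w_gt0 gain]] : exists2 kappa : R, 0 < kappa & _ :=
  multiscale_gain (divr_gt0 (divr_gt0 eps_gt0 (ltr0Sn _ 1)) cy_gt0).
have A_gt0 : 0 < A by apply: lt_le_trans A_ge1.
have m1_gt0 : 0 < m%:R + 1 :> R by rewrite ltr_wpDl.
have wR : 0 < w%:R :> R by rewrite ltr0n.
pose rho := (m%:R + 1) * (A * (A * w%:R)) * 2 / eps.
have rho_gt0 : 0 < rho.
  by apply: divr_gt0 => //; do 3?apply: mulr_gt0 => //; apply: mulr_gt0.
exists rho => //; exists (kappa^-1 + w%:R); first by rewrite addr_gt0 ?invr_gt0.
move=> D x s n D_ge0 xrun far low.
pose l0 := (Num.truncn D).+1.
have /andP[l0_le l0_gt] := truncn_itv D_ge0.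
have l0_le1 : l0%:R <= 1 + D by rewrite /l0 -natr1 addrC lerD2l.
pose L := (w * l0)%N.
have L_gt0 : (0 < L)%N by rewrite muln_gt0 w_gt0.
have LR : L%:R <= w%:R * (1 + D) by rewrite natrM ler_wpM2l // ltW.
have window_large k l : (k + l < n)%N -> (l <= w * l0)%N ->
    eps / 2 / cy * l%:R <= enorm (window_sum a s k l).
  move=> kl lL; have kn : (k < n)%N := leq_ltn_trans (leq_addr _ _) kl.
  set N := reading a I (x k).
  have N_gt0 : 0 < N.
    apply: lt_le_trans (far k kn); rewrite mulr_gt0 // ltr_pwDl //.
  have step : (m%:R + 1) * (A * (A * L%:R)) <= eps / 2 * N.
    apply: (@le_trans _ _ (eps / 2 * (rho * (1 + D)))); last first.
      by rewrite ler_wpM2l ?far // divr_ge0 // ltW.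
    have -> : eps / 2 * (rho * (1 + D)) =
        (m%:R + 1) * (A * (A * (w%:R * (1 + D)))).
      rewrite /rho; field; by rewrite gt_eqF.
    by rewrite !ler_wpM2l // ltW.
  have [y yE y_le] := hy (x k).
  have dot_le_t t : (k <= t < k + l)%N -> dot (a (s t)) y <= - (eps / 2 * N).
    move=> /andP[kt tkl]; have tn := ltn_trans tkl kl.
    have [stI _ _ _] := xrun t tn; rewrite yE //.
    have tE : t = (k + (t - k))%N by rewrite subnKC.
    have tkn : (k + (t - k) <= n)%N by rewrite -tE ltnW.
    have tL : (t - k <= L)%N.
      by apply: leq_trans lL; rewrite leq_subLR ltnW.
    have AL : A * (A * (t - k)%:R) <= A * (A * L%:R).
      by rewrite !ler_wpM2l ?(ltW A_gt0) // ler_nat.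
    have h1 := dot_step_le a_le Pa_le xrun (s t) tkn.
    have h2 := reading_run_ge xrun tkn.
    rewrite -tE in h1 h2.
    move: h1; rewrite dotBr ler_norml => /andP[h1 _].
    have h3 : eps * N <= eps * reading a I (x t) + m%:R * (A * (A * L%:R)).
      have mAL : m%:R * (A * (A * (t - k)%:R)) <= m%:R * (A * (A * L%:R)).
        by rewrite ler_wpM2l.
      have := ler_wpM2l (ltW eps_gt0) (le_trans h2 (lerD (lexx _) mAL)).
      have e1 : eps * (m%:R * (A * (A * L%:R))) <= m%:R * (A * (A * L%:R)).
        by rewrite ler_piMl // !mulr_ge0 // ltW.
      by rewrite mulrDr -/N; move: e1; lra.
    by have := low t tn; move: h1 h3 AL step; rewrite mulrDl mul1r; lra.
  have : l%:R * (eps / 2 * N) <= enorm (window_sum a s k l) * (cy * N).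
    apply: le_trans (ler_wpM2l (enorm_ge0 _) y_le).
    apply: le_trans (dot_CauchySchwarz _ _).
    rewrite -normrN; apply: le_trans (ler_norm _).
    rewrite lerNr /window_sum dot_suml.
    apply: (@le_trans _ _ (\sum_(k <= t < k + l) - (eps / 2 * N))).
      by rewrite big_nat [leRHS]big_nat; apply: ler_sum.
    by rewrite sumr_const_nat addKn mulNrn mulr_natl.
  rewrite !mulrA ler_pM2r // => h.
  by rewrite mulrAC ler_pdivrMr // mulrC mulrA.
have {}gain k : (k + L < n)%N -> kappa * L%:R <=
    dot (a (s (k + L)%N)) (x (k + L)%N) - dot (a (s k)) (x k).
  exact: (gain _ _ _ _ _ l0 D_ge0 xrun isT (ltW l0_gt) window_large).
have phi_gain q : (q * L < n)%N ->
    q%:R * (kappa * L%:R) <=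
    dot (a (s (q * L)%N)) (x (q * L)%N) - dot (a (s 0%N)) (x 0%N).
  elim: q => [|q IH] qL; first by rewrite mul0r mul0n subrr.
  have qLE : (q.+1 * L = q * L + L)%N by rewrite mulSn addnC.
  rewrite qLE in qL *; have := gain _ qL.
  have := IH (leq_ltn_trans (leq_addr _ _) qL).
  by rewrite -natr1 mulrDl mul1r; lra.
set N0 := reading a I (x 0%N).
have N0_ge0 : 0 <= N0 by apply: reading_ge0.
have ik_ge0 : 0 <= kappa^-1 by rewrite invr_ge0 ltW.
case: n => [|n] in xrun far low gain phi_gain window_large *.
  by rewrite mulr_ge0 ?addr_ge0 // ltW.
pose q := (n %/ L)%N.
have qn : (q * L < n.+1)%N by rewrite ltnS leq_divM.
have nq : (n.+1 <= q * L + L)%N by rewrite addnC -mulSn ltn_ceil.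
have := phi_gain q qn; have := low _ qn.
have eN : 0 <= eps * reading a I (x (q * L)%N).
  by rewrite mulr_ge0 ?reading_ge0 // ltW.
have [s0I _ _ _] := xrun 0%N isT.
have := dot_le_reading a (x 0%N) s0I; rewrite ler_norml -/N0 => /andP[phi0 _].
move=> lowq gainq; have : q%:R * (kappa * L%:R) <= N0 by lra.
rewrite mulrCA mulrC -ler_pdivlMr // => qLN.
apply: (@le_trans _ _ (q * L + L)%:R); first by rewrite ler_nat.
rewrite natrD natrM mulrDl; apply: lerD.
  by apply: le_trans qLN _; rewrite mulrC ler_wpM2l // lerDr addr_ge0.
by apply: le_trans LR _; rewrite ler_wpM2l ?(ltW wR) ?lerDl.
Qed.

(** * Boundedness of near-minimal runs *)

(** For the sum S of the selected vectors, <S, P S> only involves readings of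
    the displacement P S, and dominates lam |S|^2. *)
Lemma displacement_le_reading I :
  exists2 c : R, 0 < c & forall (D : R) x s n, near_min_run a P I D x s n ->
    enorm (x n - x 0%N) <= c * (reading a I (x n) + reading a I (x 0%N)).
Proof.
have [cy cy_gt0 hy] := bounded_representative a I.
have [cP cP_gt0 hP] := mulmx_bounded P.
exists (cP * (cy / lam)) => [|D x s n xrun]; first by rewrite mulr_gt0 ?divr_gt0.
set v := x n - x 0%N.
set S := window_sum a s 0 n.
have vE : v = P *m S.
  by rewrite /v -[n in x n]add0n (run_displacement xrun) // addrC addKr.
have [y yE y_le] := hy v.
have Sy : dot S y = dot S v by apply: (dot_window_sum xrun _ yE).
have S_le : lam * enorm S <= cy * reading a I v.
  have [->|S_n0] := eqVneq (enorm S) 0.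
    by rewrite mulr0 mulr_ge0 ?reading_ge0 // ltW.
  have S_gt0 : 0 < enorm S by rewrite lt_def S_n0 enorm_ge0.
  rewrite -(ler_pM2l S_gt0) mulrCA -expr2 -enormE.
  apply: le_trans (P_coercive _) _; rewrite -vE -Sy.
  by apply: le_trans (dot_le _ _) _; rewrite ler_wpM2l ?enorm_ge0.
rewrite {1}vE; apply: le_trans (hP _) _; rewrite -mulrA ler_wpM2l ?(ltW cP_gt0) //.
rewrite mulrAC ler_pdivlMr // mulrC; apply: le_trans S_le _.
rewrite ler_wpM2l ?(ltW cy_gt0) //.
by apply: le_trans (readingD _ _ _ _) _; rewrite readingN.
Qed.

(** Track the last entrance into the region of large readings: from there the
    run descends for a controlled time, until it returns to moderate readings
    or is trapped for good. *)
Theorem near_min_run_bounded I :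
  exists2 c : R, 0 <= c & forall (D : R) x s n, 0 <= D -> near_min_run a P I D x s n ->
    enorm (x n - x 0%N) <= c * (1 + D + reading a I (x 0%N)).
Proof.
have [k] := ubnP #|I|; elim: k I => // k IH I Ik.
have [C1 C1_ge0 {}IH] : exists2 c : R, 0 <= c & forall J, J \proper I ->
    forall (D : R) x s n, 0 <= D -> near_min_run a P J D x s n ->
    enorm (x n - x 0%N) <= c * (1 + D + reading a J (x 0%N)).
  have /choice[c hc] : forall J : {set 'I_m}, exists c : R, J \proper I -> 0 <= c /\
      forall (D : R) x s n, 0 <= D -> near_min_run a P J D x s n ->
      enorm (x n - x 0%N) <= c * (1 + D + reading a J (x 0%N)).
    move=> J; have [JI|] := boolP (J \proper I); last by exists 0.
    have [|c c0 hc] := IH J; first exact: leq_trans (proper_card JI) Ik.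
    by exists c.
  exists (\sum_(J : {set 'I_m} | J \proper I) c J) => [|J JI D x s n D0 xrun].
    by apply: sumr_ge0 => J /hc[].
  have [c0 /(_ _ _ _ _ D0 xrun) /le_trans] := hc J JI; apply.
  rewrite ler_wpM2r ?addr_ge0 ?reading_ge0 // (bigD1 J) //= lerDl.
  by apply: sumr_ge0 => K /andP[/hc[]].
clear k Ik; have A_ge0 := le_trans ler01 A_ge1.
have [eps [eps_gt0 eps_le1 trapped]] := trapped_run A_ge1 a_le C1_ge0 IH.
have [rho rho_gt0 [c2 c2_gt0 descent]] := descent_time I eps_gt0 eps_le1.
have [c4 c4_gt0 displ] := displacement_le_reading I.
(* A step changes the total reading by at most b.  The y's bound it, in units
   of E below, on entering the region of large readings, while descending, and
   when trapped. *)
pose b := m%:R * (A * A).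
have b_ge0 : 0 <= b by rewrite /b !mulr_ge0.
(* Readings above r (1 + D) are large enough for both regimes. *)
pose r := rho + eps^-1.
have r_ge0 : 0 <= r by rewrite /r addr_ge0 ?invr_ge0 // ltW.
pose y1 := 1 + r + b; pose y2 := y1 + b * (c2 * (1 + y1)).
pose y3 := y2 + m%:R * (A * (C1 * (1 + y2))).
have y1_ge0 : 0 <= y1 by rewrite /y1 addr_ge0 // addr_ge0.
have y2_ge0 : 0 <= y2.
  by rewrite /y2 addr_ge0 // mulr_ge0 // mulr_ge0 ?(ltW c2_gt0) // addr_ge0.
have y3_ge0 : 0 <= y3 by rewrite /y3 addr_ge0 // !mulr_ge0 // addr_ge0.
exists (c4 * (y3 + 1)) => [|D x s n D_ge0 xrun].
  by rewrite mulr_ge0 ?(ltW c4_gt0) // addr_ge0.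
set N := fun t => reading a I (x t).
have N_ge0 t : 0 <= N t by apply: reading_ge0.
set E := 1 + D + N 0%N.
have E_ge0 : 0 <= E by rewrite /E !addr_ge0.
have E1 : 1 + D <= E by rewrite lerDl.
have one_le_E : 1 <= E by rewrite /E -addrA lerDl addr_ge0.
have N_step t l : (t + l <= n)%N -> N (t + l)%N <= N t + b * l%:R.
  move=> tl; have := reading_run_le A_ge1 a_le Pa_le xrun tl.
  by rewrite /b -!mulrA.
have start : N 0%N <= y1 * E.
  apply: (@le_trans _ _ E); first by rewrite lerDr addr_ge0.
  by rewrite ler_peMl // /y1 -addrA lerDl addr_ge0.
(* One step from a moderate reading overshoots by at most b. *)
have reenter t : (t < n)%N -> N t < r * (1 + D) -> N t.+1 <= y1 * E.
  rewrite -addn1 => tn Nt; apply: le_trans (N_step _ _ tn) _.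
  rewrite mulr1 /y1 (mulrDl _ b) (mulrDl 1) mul1r; have := ler_peMr b_ge0 one_le_E.
  by have := ler_wpM2l r_ge0 E1; move: Nt E_ge0; lra.
pose descending k := exists k1, [/\ (k1 <= k)%N, N k1 <= y1 * E &
  forall t, (k1 <= t < k)%N -> r * (1 + D) <= N t /\
    dot (a (s t)) (x t) < - (eps * N t)].
pose caught k := exists k2, [/\ (k2 <= k)%N, (k2 < n)%N, N k2 <= y2 * E,
  r * (1 + D) <= N k2 & - (eps * N k2) <= dot (a (s k2)) (x k2)].
have descendingN k : (k <= n)%N -> descending k -> N k <= y2 * E.
  move=> kn [k1 [k1k Nk1 hk1]].
  have kE : k = (k1 + (k - k1))%N by rewrite subnKC.
  have run1 := near_min_run_prefix (leq_sub2r k1 kn)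
    (near_min_run_shift (leq_trans k1k kn) xrun).
  have time_le : (k - k1)%:R <= c2 * (1 + D + N k1).
    rewrite -[k1 in N k1]addn0; apply: (descent _ _ _ _ D_ge0 run1) => t;
      rewrite ltn_subRL => tk; have [|far low] := hk1 (k1 + t)%N;
      rewrite ?leq_addr //.
    apply: le_trans far; rewrite ler_wpM2r ?addr_ge0 // lerDl invr_ge0 ltW //.
  have stepN : N k <= N k1 + b * (k - k1)%:R by rewrite [k in N k]kE N_step // -kE.
  have : b * (k - k1)%:R <= b * (c2 * (1 + y1)) * E.
    rewrite -mulrA ler_wpM2l //; apply: le_trans time_le _.
    rewrite -mulrA ler_wpM2l ?(ltW c2_gt0) // mulrDl mul1r; exact: lerD.
  by rewrite /y2 mulrDl; move: stepN Nk1; lra.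
have caughtN k : (k <= n)%N -> caught k -> N k <= y3 * E.
  move=> kn [k2 [k2k k2n Nk2 far low]].
  have run2 := near_min_run_prefix (leq_sub2r k2 kn)
    (near_min_run_shift (ltnW k2n) xrun).
  have := trapped _ _ _ _ D_ge0 run2; rewrite /= addn0 subnKC // -/(N k2).
  have epsN : 1 + D <= eps * N k2.
    rewrite -ler_pdivrMl // mulrC; apply: le_trans far.
    by rewrite mulrC ler_wpM2r ?addr_ge0 // lerDr ltW.
  have low_all i : i \in I -> - (2 * eps * N k2) <= dot (a i) (x k2).
    move=> iI; have [_ smin _ _] := xrun k2 k2n; have := smin i iI.
    by move: low epsN; rewrite -mulrA; lra.
  move=> /(_ epsN low_all) step.
  have Nk : N k <= N k2 + m%:R * (A * enorm (x k - x k2)).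
    have := readingD a I (x k2) (x k - x k2); rewrite addrC subrK.
    by move/le_trans; apply; rewrite lerD2l reading_le_enorm.
  apply: le_trans Nk _; rewrite /y3 mulrDl; apply: lerD => //.
  rewrite -!mulrA !ler_wpM2l //; apply: le_trans step _.
  by rewrite ler_wpM2l // mulrDl mul1r lerD.
have status k : (k <= n)%N -> descending k \/ caught k.
  elim: k => [|k IHk] kn.
    by left; exists 0%N; split=> // t; rewrite ltn0 andbF.
  have [des|[k2 [k2k ? ? ? ?]]] := IHk (ltnW kn); last first.
    by right; exists k2; split=> //; apply: leqW.
  have Nk := descendingN _ (ltnW kn) des.
  have [near|far] := ltP (N k) (r * (1 + D)).
    left; exists k.+1; split=> // [|t]; first exact: reenter.
    by move=> /andP[kt]; rewrite ltnS leqNgt kt.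
  have [stuck|low] := leP (- (eps * N k)) (dot (a (s k)) (x k)).
    by right; exists k; split.
  have [k1 [k1k Nk1 hk1]] := des; left; exists k1; split=> // [|t].
    exact: leqW.
  rewrite ltnS => /andP[k1t]; rewrite leq_eqVlt => /predU1P[->|tk] //.
  by apply: hk1; rewrite k1t.
have Nn : N n <= y3 * E.
  have [des|cau] := status n (leqnn n); last exact: caughtN.
  apply: le_trans (descendingN _ (leqnn n) des) _; rewrite ler_wpM2r //.
  by rewrite /y3 lerDl !mulr_ge0 // addr_ge0.
apply: le_trans (displ _ _ _ _ xrun) _; rewrite -/(N n) -/(N 0%N).
rewrite -mulrA ler_wpM2l ?(ltW c4_gt0) // mulrDl mul1r lerD //.
by rewrite lerDr addr_ge0.
Qed.
End Bounded.

(** * The relaxation procedure *)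

Section ObliqueRun.
Variables (R : realType) (m n : nat).
Variables (a : 'I_m.+1 -> 'cV[R]_n.+1) (P : 'M[R]_n.+1).
Variables (b : 'I_m.+1 -> R) (B : R) (x0 : 'cV[R]_n.+1).
Variable x : nat -> 'cV[R]_n.+1.
Hypothesis xrun : oblique_run a b P B x0 x.

Lemma bounds_in_spread : exists lo hi : R,
  [/\ lo <= 0, 0 <= hi, (forall i, lo <= b i <= hi) & spread b = hi - lo].
Proof.
exists (\big[Num.min/0]_(i < m.+1) b i), (\big[Num.max/0]_(i < m.+1) b i).
split=> // [||i]; first exact: bigmin_le_id.
- exact: bigmax_ge_id.
- by rewrite bigmin_le le_bigmax.
Qed.

Lemma spread_ge0 : 0 <= spread b.
Proof. by have [lo [hi [? ? _ ->]]] := bounds_in_spread; lra. Qed.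

(** Infeasibility makes the least residual negative, so the selected reading is
    below b_i + B; comparing readings instead of residuals costs b_i - b_j.
    Both b_i and b_i - b_j are at most the spread. *)
Lemma oblique_near_min_run : exists s, forall k,
  (forall t, (t < k)%N -> ~ feasible a b (x t)) ->
  near_min_run a P [set: 'I_m.+1]%SET (B + spread b) x s k.
Proof.
have [lo [hi [lo0 hi0 bE spE]]] := bounds_in_spread.
have /choice[s hs] : forall t, exists i, ~ feasible a b (x t) ->
    residual a b (x t) i <= min_residual a b (x t) + B /\
    x t.+1 = x t + P *m a i.
  move=> t; have [_ step] := xrun; have [_ {}step] := step t.
  have [f|/step[i hi']] := pselect (feasible a b (x t)); last by exists i.
  by exists ord0.
exists s => k infeas t tk; have [min_s xS] := hs t (infeas t tk).
have min_le j : min_residual a b (x t) <= residual a b (x t) j.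
  exact: bigmin_le.
split=> // [|j _|]; first by rewrite inE.
  have := bE (s t); have := bE j; have := min_le j; move: min_s.
  by rewrite /residual spE => + + /andP[+ _] /andP[_ +]; lra.
have [j] : exists j, dot (a j) (x t) < b j.
  by have /existsNP[j /negP] := infeas t tk; rewrite -ltNge; exists j.
have := bE (s t); have := min_le j; move: min_s.
by rewrite /residual spE => + + /andP[_ +]; lra.
Qed.

(** The state is frozen after stopping, so every iterate is already reached
    before it. *)
Lemma first_feasible k : exists T, [/\ (T <= k)%N, x k = x T,
  forall t, (t < T)%N -> ~ feasible a b (x t) & T = k \/ feasible a b (x T)].
Proof.
elim: k => [|k [T [Tk xkT infeas Tor]]]; first by exists 0%N; split=> //; left.
have [_ /(_ k)[stay _]] := xrun.
have [feas|nfeas] := pselect (feasible a b (x k)).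
  exists T; split=> //; first exact: leqW.
    by rewrite stay.
  by right; rewrite -xkT.
exists k.+1; split=> // [t|]; last by left.
have Tk' : T = k by case: Tor => // feasT; rewrite xkT in nfeas.
rewrite Tk' in infeas.
by rewrite ltnS leq_eqVlt => /predU1P[->|/infeas].
Qed.

Lemma infeasible_steps_le k (c : 'cV[R]_n.+1) (gamma M : R) : 0 < gamma ->
  (forall i, gamma <= dot c (P *m a i)) -> enorm (x k) <= M ->
  (forall t, (t < k)%N -> ~ feasible a b (x t)) ->
  k%:R <= enorm c / gamma * (M + enorm x0).
Proof.
move=> gamma_gt0 hc xkM infeas; have [s hs] := oblique_near_min_run.
have run := hs k infeas.
have progress : gamma * k%:R <= dot c (x k - x 0%N).
  rewrite -[k in x k]add0n (run_displacement run) // addrC addKr.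
  rewrite /window_sum add0n mulmx_sumr dotC dot_suml.
  apply: (@le_trans _ _ (\sum_(0 <= t < k) gamma)).
    by rewrite sumr_const_nat subn0 mulr_natr.
  by apply: ler_sum => t _; rewrite dotC.
rewrite mulrAC ler_pdivlMr // mulrC; apply: le_trans progress _.
apply: le_trans (dot_le _ _) _; rewrite ler_wpM2l ?enorm_ge0 //.
have [x00 _] := xrun; rewrite x00.
apply: le_trans (ler_enormD _ _) _; apply: lerD => //.
by rewrite -scaleN1r enormZ normrN1 mul1r.
Qed.

End ObliqueRun.

Theorem proposition3 (R : realType) (m n : nat)
    (a : 'I_m.+1 -> 'cV[R]_n.+1) (P : 'M[R]_n.+1)
    (hP : pos_def (sym_part P)) :
  exists C : R, 1 <= C /\
    forall (b : 'I_m.+1 -> R) (B : R) (x0 : 'cV[R]_n.+1)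
      (x : nat -> 'cV[R]_n.+1),
      0 <= B -> oblique_run a b P B x0 x ->
      let M := C * (1 + enorm x0 + B + spread b) in
      (ereal_sup (range (fun k : nat => (enorm (x k))%:E)) <= M%:E)%E /\
      (forall (c : 'cV[R]_n.+1) (gamma : R), 0 < gamma ->
         (forall i : 'I_m.+1, gamma <= dot c (P *m a i)) ->
         exists T : nat, stops_at a b x T /\
           T%:R <= enorm c / gamma * (M + enorm x0)).
Proof.
have [lam lam_gt0 hlam] := pos_def_coercive hP.
have coercive (v : 'cV[R]_n.+1) : lam * dot v v <= dot v (P *m v).
  by rewrite -dot_sym_part.
(* One bound for all |a i| and |P a i|. *)
pose A := 1 + \sum_i (enorm (a i) + enorm (P *m a i)).
have enorms_ge0 i : 0 <= enorm (a i) + enorm (P *m a i).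
  by rewrite addr_ge0 ?enorm_ge0.
have A_ge1 : 1 <= A by rewrite lerDl; apply: sumr_ge0.
have term_le i : enorm (a i) + enorm (P *m a i) <= A.
  rewrite /A (bigD1 i) //= addrCA lerDl addr_ge0 //; exact: sumr_ge0.
have a_le i : enorm (a i) <= A.
  by apply: le_trans (term_le i); rewrite lerDl enorm_ge0.
have Pa_le i : enorm (P *m a i) <= A.
  by apply: le_trans (term_le i); rewrite lerDr enorm_ge0.
have [c c_ge0 bounded] :=
  near_min_run_bounded A_ge1 a_le Pa_le lam_gt0 coercive [set: 'I_m.+1]%SET.
pose K := m.+1%:R * A.
have K_ge0 : 0 <= K by rewrite /K mulr_ge0 // (le_trans ler01 A_ge1).
exists (1 + c * (1 + K)); split; first by rewrite lerDl mulr_ge0 ?addr_ge0.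
move=> b B x0 x B_ge0 xrun M.
have [s near_min] := oblique_near_min_run xrun.
have [x00 _] := xrun.
have x_le k : enorm (x k) <= M.
  have [T [_ -> infeas _]] := first_feasible xrun k.
  have D_ge0 : 0 <= B + spread b by rewrite addr_ge0 ?spread_ge0.
  have := bounded _ _ _ _ D_ge0 (near_min T infeas); rewrite x00 => moved.
  have read_le := reading_le_enorm A_ge1 a_le [set: 'I_m.+1]%SET x0.
  have E_ge0 : 0 <= 1 + (B + spread b) by rewrite addr_ge0.
  have x0_ge0 := enorm_ge0 x0.
  apply: (@le_trans _ _ (enorm x0 + enorm (x T - x0))).
    by rewrite -{1}[x T](subrK x0) addrC ler_enormD.
  rewrite /M mulrDl mul1r.
  apply: lerD.
    by move: E_ge0; lra.
  apply: le_trans moved _; rewrite -mulrA ler_wpM2l //.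
  move: read_le; rewrite mulrA -/K => read_le.
  have := mulr_ge0 K_ge0 E_ge0; rewrite mulrDl mul1r -!addrA !mulrDr; lra.
split.
  by apply: ge_ereal_sup => _ [k _ <-]; rewrite lee_fin.
move=> e gamma gamma_gt0 he.
have steps_le k := infeasible_steps_le xrun gamma_gt0 he (x_le k).
set bnd := enorm e / gamma * _ in steps_le *.
have [T feasT] : exists T, feasible a b (x T).
  apply: contrapT => /forallNP infeas.
  have := steps_le (Num.bound bnd) (fun t _ => infeas t).
  have bnd_ge0 : 0 <= bnd by apply: le_trans (steps_le 0%N _).
  by rewrite leNgt archi_boundP.
have [T' [T'T xT infeas _]] := first_feasible xrun T.
by exists T'; split; [split; rewrite // -xT | apply: steps_le].
Qed.
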